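(* Let $\mathbb{F}$ be a commutative field of characteristic $0$, let $n \geq 2$ be an integer, and let $f:\mathbb{R}^n \to \mathbb{F}^n$ preserve unit distance. If $x,y \in \mathbb{R}^n$ and $x \neq y$, then $\varphi_n(f(x),f(y)) \neq 0$.
   Context: For $u=(u_1,\dots,u_n)$, $v=(v_1,\dots,v_n)\in\mathbb{F}^n$, $\varphi_n(u,v)=(u_1-v_1)^2+\dots+(u_n-v_n)^2\in\mathbb{F}$. A map $f:\mathbb{R}^n\to\mathbb{F}^n$ preserves unit distance if for all $x,y\in\mathbb{R}^n$, $|x-y|=1$ (Euclidean distance) implies $\varphi_n(f(x),f(y))=1$. *)

(* Defs.v *)
From mathcomp Require Import all_boot all_order all_algebra.
From mathcomp Require Import reals.

Set Implicit Arguments.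
Unset Strict Implicit.
Unset Printing Implicit Defensive.

Import Order.TTheory GRing.Theory Num.Theory.
Local Open Scope ring_scope.

Definition phi (F : fieldType) (n : nat) (u v : 'rV[F]_n) : F :=
  \sum_(i < n) (u 0 i - v 0 i) ^+ 2.

(* MathComp-Analysis's canonical norm on row vectors is the sup norm, hence
   this explicit Euclidean distance. *)
Definition euclidean_dist (R : realType) (n : nat) (x y : 'rV[R]_n) : R :=
  Num.sqrt (\sum_(i < n) (x 0 i - y 0 i) ^+ 2).

Definition preserves_unit_distance (R : realType) (F : fieldType) (n : nat)
    (f : 'rV[R]_n -> 'rV[F]_n) : Prop :=
  forall x y : 'rV[R]_n, euclidean_dist x y = 1 -> phi (f x) (f y) = 1.

(* Main.v *)
Require Import Defs.
From mathcomp Require Import all_boot all_order all_algebra.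
From mathcomp Require Import reals.
From mathcomp Require Import ring lra.

(** Distances are measured by phi throughout, that is, squared; phi also makes
    sense on the real side.  Write N for the dimension and L = 2 + 2 / N.

    Two points at distance a from all N vertices of a regular simplex with edge
    b (all squared) lie at distance c = 4 a - 2 (N - 1) / N b from each other.
    In F^N the edge vectors of such a simplex span a nondegenerate hyperplane,
    whose orthogonal complement is an anisotropic line; so if f carries a and b
    to a' and b' <> 0, then two points at distance c have either the same image
    or images at the corresponding distance c' ([double_pyramid]).  Coincidence
    of the images is excluded by a third point, at distance c from one of them
    and at a distance p <> c, already known to be carried, from the other
    ([carries_pyramid]).  Starting from the unit distance, a = b gives that f
    carries every power L ^ k, and then a = L ^ k with b = 1 or b = L gives two
    further families of carried distances, 4 L ^ k - 2 (N - 1) / N and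
    4 L ^ k - 2 (N - 1) / N L.

    Suppose now phi (f x) (f y) = 0, and choose k so that L ^ k is large
    compared with phi x y.  There are N - 1 points at mutual distance L ^ k, all
    at distance L ^ k from both x and y.  In F^N the vector u = f y - f x is
    orthogonal to the vectors from f x to the images of these points, because
    phi (f x) (f y) = 0; these N - 1 vectors span a nondegenerate hyperplane, so
    the isotropic vector u vanishes and f x = f y ([isotropic_collapse]).

    Finally f is injective ([carries_injective]).  The two families above have a
    constant difference while both tend to infinity, so the difference of the
    underlying Euclidean lengths tends to 0; hence for any x <> y some z is at
    distance 4 L ^ k - 2 (N - 1) / N from x and 4 L ^ k - 2 (N - 1) / N L from
    y.  The images of these two numbers in F differ, so f x <> f y. *)

Set Implicit Arguments.
Unset Strict Implicit.
Unset Printing Implicit Defensive.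

Import Order.TTheory GRing.Theory Num.Theory.
Local Open Scope ring_scope.

(** * The bilinear form behind phi *)

Section Dot.
Variables (F : fieldType) (n : nat).
Implicit Types u v w x y : 'rV[F]_n.

Definition dot u v : F := \sum_i u 0 i * v 0 i.

Lemma dotC u v : dot u v = dot v u.
Proof. by apply: eq_bigr => i _; rewrite mulrC. Qed.

Lemma dotDl u v w : dot (u + v) w = dot u w + dot v w.
Proof. by rewrite -big_split; apply: eq_bigr => i _; rewrite mxE mulrDl. Qed.

Lemma dotZl a u v : dot (a *: u) v = a * dot u v.
Proof. by rewrite mulr_sumr; apply: eq_bigr => i _; rewrite mxE mulrA. Qed.

Lemma dotNl u v : dot (- u) v = - dot u v.
Proof. by rewrite -scaleN1r dotZl mulN1r. Qed.

Lemma dotDr u v w : dot u (v + w) = dot u v + dot u w.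
Proof. by rewrite !(dotC u) dotDl. Qed.

Lemma dotZr a u v : dot u (a *: v) = a * dot u v.
Proof. by rewrite !(dotC u) dotZl. Qed.

Lemma dotNr u v : dot u (- v) = - dot u v.
Proof. by rewrite !(dotC u) dotNl. Qed.

Lemma dot0l u : dot 0 u = 0.
Proof. by rewrite -(scale0r 0) dotZl mul0r. Qed.

Lemma dot_suml (I : finType) (V : I -> 'rV[F]_n) u :
  dot (\sum_i V i) u = \sum_i dot (V i) u.
Proof.
apply: (big_rec2 (fun s t => dot s u = t)) => [|i s t _ <-]; first exact: dot0l.
by rewrite dotDl.
Qed.

Definition dotE := (dotDl, dotDr, dotNl, dotNr, dotZl, dotZr).

Lemma phi_dot u v : phi u v = dot (u - v) (u - v).
Proof. by apply: eq_bigr => i _; rewrite !mxE expr2. Qed.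

Lemma phiC u v : phi u v = phi v u.
Proof. by apply: eq_bigr => i _; rewrite -sqrrN opprB. Qed.

Lemma phixx u : phi u u = 0.
Proof. by rewrite phi_dot subrr dot0l. Qed.

(** Polarization: the inner products of differences depend on the values of phi
    only, so they are known as soon as the distances are. *)
Lemma dot_phi u v x y :
  2 * dot (u - v) (x - y) = phi u y + phi v x - phi u x - phi v y.
Proof.
rewrite !phi_dot !dotE (dotC y u) (dotC x v) (dotC x u) (dotC y v); ring.
Qed.

End Dot.

Lemma dot_mulmx (F : fieldType) n m (V : 'M[F]_(m, n)) (u : 'rV[F]_n) i :
  (u *m V^T) 0 i = dot u (row i V).
Proof. by rewrite !mxE; apply: eq_bigr => j _; rewrite !mxE. Qed.

(** * Simplices in the target space *)

(** The orthogonal complement of a nondegenerate hyperplane is an anisotropic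
    line, on which the form has no zero divisors.  The case u = w says that
    this line contains no isotropic vector. *)
Lemma orthogonal_line (F : fieldType) n (V : 'M[F]_(n, n.+1))
    (u w : 'rV[F]_n.+1) :
    V *m V^T \in unitmx -> u *m V^T = 0 -> w *m V^T = 0 -> dot u w = 0 ->
  u = 0 \/ w = 0.
Proof.
move=> unitG uV wV uw; case: (eqVneq w 0) => [->|w_neq0]; [by right | left].
(* V and w together form a basis: pairing a relation with V kills w. *)
have free z t : z *m V + t *: w = 0 -> z = 0 /\ t = 0.
  move=> zt0; have z0 : z = 0.
    have: (z *m V + t *: w) *m V^T = 0 by rewrite zt0 mul0mx.
    rewrite mulmxDl -scalemxAl wV scaler0 addr0 -mulmxA.
    move=> /(congr1 (mulmxr (invmx (V *m V^T)))).
    by rewrite /= mulmxK // mul0mx.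
  split=> //; move/eqP: zt0; rewrite z0 mul0mx add0r scaler_eq0 (negPf w_neq0).
  by rewrite orbF => /eqP.
pose M := col_mx V w.
have freeM : row_free M.
  apply/inj_row_free => z; rewrite -(hsubmxK z) mul_row_col.
  rewrite (mx11_scalar (rsubmx z)) mul_scalar_mx => /free[-> ->].
  by rewrite raddf0 row_mx0.
apply/eqP; rewrite -(@mulmx_free_eq0 _ _ _ _ _ M^T).
  rewrite tr_col_mx mul_mx_row uV; apply/eqP/rowP=> i; rewrite !mxE.
  case: split => k; rewrite !mxE //.
  by rewrite -[RHS]uw; apply: eq_bigr => j _; rewrite !mxE ord1.
by rewrite /row_free mxrank_tr (eqP freeM) addn1.
Qed.

Section CharZero.
Variables (F : fieldType) (charF0 : [pchar F] =i pred0).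

Lemma pchar0_natr_neq0 m : m.+1%:R != 0 :> F.
Proof. by rewrite ((pcharf0P F).1 charF0). Qed.
Local Hint Resolve pchar0_natr_neq0 : core.

(** The Gram matrix is b / 2 (I + J) with J the all-ones matrix, and
    J ^ 2 = n J, so its inverse is 2 / b (I - J / (n + 1)). *)
Lemma simplex_gram_unit n N (b : F) (P0 : 'rV[F]_N) (Q : 'I_n -> 'rV[F]_N) :
    b != 0 -> (forall i, phi (Q i) P0 = b) ->
    (forall i j, i != j -> phi (Q i) (Q j) = b) ->
  (\matrix_i (Q i - P0)) *m (\matrix_i (Q i - P0))^T \in unitmx.
Proof.
move=> b_neq0 QP QQ; set V := \matrix_i _.
pose J : 'M[F]_n := const_mx 1.
have n1_neq0 := pchar0_natr_neq0 n; have two_neq0 := pchar0_natr_neq0 1.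
have JJ : J *m J = n%:R *: J.
  apply/matrixP=> i j; rewrite !mxE (eq_bigr (fun=> 1)) => [|k _].
    by rewrite sumr_const card_ord mulr1.
  by rewrite !mxE mulr1.
have -> : V *m V^T = (b / 2) *: (1%:M + J).
  apply/matrixP=> i j; rewrite !mxE.
  under eq_bigr => k _ do rewrite [V _ _]mxE [V^T _ _]mxE [V _ _]mxE.
  rewrite -/(dot _ _); apply: (mulfI two_neq0).
  rewrite dot_phi QP (phiC P0) QP phixx.
  case: eqVneq => [->|/QQ ->]; rewrite ?phixx /=; by field.
suff: (b / 2) *: (1%:M + J) *m ((2 / b) *: (1%:M - n.+1%:R^-1 *: J)) = 1%:M.
  by case/mulmx1_unit.
rewrite -scalemxAl -scalemxAr scalerA mulmxDl mul1mx mulmxBr mulmx1 -scalemxAr.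
rewrite JJ; apply/matrixP=> i j; rewrite !mxE.
by field; rewrite nat1r n1_neq0 b_neq0.
Qed.

Lemma simplex_normal n (b : F) (P0 : 'rV[F]_n.+1)
    (Q : 'I_n -> 'rV[F]_n.+1) u w :
    b != 0 -> (forall i, phi (Q i) P0 = b) ->
    (forall i j, i != j -> phi (Q i) (Q j) = b) ->
    (forall i, dot u (Q i - P0) = 0) -> (forall i, dot w (Q i - P0) = 0) ->
    dot u w = 0 ->
  u = 0 \/ w = 0.
Proof.
move=> b_neq0 QP QQ uQ wQ.
apply: orthogonal_line (simplex_gram_unit b_neq0 QP QQ) _ _.
  by apply/rowP=> i; rewrite dot_mulmx rowK uQ mxE.
by apply/rowP=> i; rewrite dot_mulmx rowK wQ mxE.
Qed.

(** With C the centroid of the P i, both X - C and Y - C lie on the anisotropic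
    line orthogonal to the simplex and have the same square; hence X - C is
    Y - C or its opposite. *)
Lemma double_pyramid n (a b : F)
    (P : 'I_n.+1 -> 'rV[F]_n.+1) (X Y : 'rV[F]_n.+1) :
    b != 0 -> (forall i j, i != j -> phi (P i) (P j) = b) ->
    (forall i, phi X (P i) = a) -> (forall i, phi Y (P i) = a) ->
  X = Y \/ phi X Y = 4 * a - 2 * n%:R / n.+1%:R * b.
Proof.
move=> b_neq0 PP XP YP.
have n1_neq0 := pchar0_natr_neq0 n; have two_neq0 := pchar0_natr_neq0 1.
pose C := n.+1%:R^-1 *: \sum_i P i.
have subC (Z : 'rV_n.+1) : Z - C = n.+1%:R^-1 *: \sum_i (Z - P i).
  rewrite sumrB sumr_const card_ord scalerBr -scaler_nat scalerA.
  by rewrite mulVf // scale1r.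
have sumP i : \sum_j phi (P j) (P i) = n%:R * b.
  rewrite (bigD1 i) //= phixx add0r (eq_bigr (fun=> b)) => [|j /PP //].
  by rewrite sumr_const cardC1 card_ord mulr_natl.
have CP Z i : (forall i, phi Z (P i) = a) -> dot (Z - C) (P i - P ord0) = 0.
  move=> ZP; rewrite subC dotZl dot_suml; apply/eqP.
  rewrite mulf_eq0; apply/orP; right; rewrite -(mulrI_eq0 _ (mulfI two_neq0)).
  rewrite mulr_sumr; under eq_bigr => j _ do rewrite dot_phi !ZP (addrC a) addrK.
  by rewrite sumrB !sumP subrr.
have CC Z : (forall i, phi Z (P i) = a) ->
    dot (Z - C) (Z - C) = a - n%:R / n.+1%:R * b / 2.
  move=> ZP; rewrite {1}subC dotZl dot_suml; apply: (mulfI two_neq0).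
  rewrite mulrCA mulr_sumr.
  have E i : 2 * dot (Z - P i) (Z - C) = 2 * a - n%:R / n.+1%:R * b.
    rewrite subC dotZr dotC dot_suml mulrCA mulr_sumr.
    under eq_bigr => j _ do rewrite dot_phi phixx !ZP (phiC _ Z) ZP.
    rewrite sumrB sumP sumr_const card_ord -mulr_natl; by field; rewrite nat1r.
  rewrite (eq_bigr _ (fun i _ => E i)) sumr_const card_ord -[X in _ * X = _]mulr_natl.
  by field; rewrite nat1r n1_neq0 two_neq0.
pose Q i := P (lift ord0 i).
have [||||||/eqP|/eqP] :=
  @simplex_normal n b (P ord0) Q (X - Y) ((X - C) + (Y - C)).
- done.
- by move=> i; rewrite PP.
- by move=> i j ij; rewrite PP // (inj_eq lift_inj).
- by move=> i; apply: (mulfI two_neq0); rewrite dot_phi !XP !YP mulr0; ring.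
- by move=> i; rewrite dotDl !CP // addr0.
- have -> : X - Y = (X - C) - (Y - C) by rewrite opprB addrA subrK.
  move: (CC X XP) (CC Y YP); move: (X - C) (Y - C) => g h gg hh.
  by rewrite !dotE gg hh (dotC h); ring.
- by rewrite subr_eq0 => /eqP; left.
rewrite addr_eq0 => /eqP YC; right.
have -> : phi X Y = 4 * dot (X - C) (X - C).
  have -> : phi X Y = dot ((X - C) - (Y - C)) ((X - C) - (Y - C)).
    by rewrite phi_dot opprB addrA subrK.
  have -> : Y - C = - (X - C) by rewrite YC opprK.
  by rewrite opprK !dotE; ring.
by rewrite CC //; field; rewrite nat1r n1_neq0.
Qed.

End CharZero.

(** * Point configurations in the real space *)

Section Householder.
Variables (F : fieldType) (n : nat).
Implicit Types u v w : 'rV[F]_n.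

(** The reflection in the hyperplane orthogonal to w, and the identity when w is
    isotropic, as then the quotient is 0. *)
Definition householder w v := v - (2 * dot v w / dot w w) *: w.

Lemma householderB w u v :
  householder w u - householder w v = householder w (u - v).
Proof.
rewrite /householder dotDl dotNl mulrBr mulrBl scalerBl.
by rewrite !opprD !opprK addrACA.
Qed.

Lemma householderN w v : householder w (- v) = - householder w v.
Proof. by rewrite /householder dotNl mulrN mulNr scaleNr opprD. Qed.

Lemma dot_householder w v : dot (householder w v) (householder w v) = dot v v.
Proof.
rewrite /householder; have [ww|ww] := eqVneq (dot w w) 0.
  by rewrite ww invr0 mulr0 scale0r subr0.
by rewrite !dotE (dotC w v); field.
Qed.

(** s E_i + t E_k + c (1, ..., 1), with E_i the standard basis.  Scaled standard
    basis vectors form a regular simplex in a hyperplane orthogonal to the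
    diagonal, so all configurations below can be written in this form once the
    two given points have been moved to the diagonal. *)
Definition spikes (s : F) (i : 'I_n) (t : F) (k : 'I_n) (c : F) : 'rV[F]_n :=
  \row_j (s * (j == i)%:R + t * (j == k)%:R + c).

Lemma dot_spikes s i t k c :
  dot (spikes s i t k c) (spikes s i t k c)
  = s ^+ 2 + t ^+ 2 + 2 * s * t * (i == k)%:R + n%:R * c ^+ 2
    + 2 * (s + t) * c.
Proof.
have sum1 l : \sum_j (j == l)%:R = 1 :> F.
  by rewrite (bigD1 l) //= eqxx big1 ?addr0 // => j /negPf ->.
have sum2 : \sum_j (j == i)%:R * (j == k)%:R = (i == k)%:R :> F.
  rewrite (bigD1 i) //= eqxx mul1r big1 ?addr0 // => j /negPf ->.
  by rewrite mul0r.
transitivity (\sum_(j < n) ((s ^+ 2 + 2 * s * c) * (j == i)%:R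
   + (t ^+ 2 + 2 * t * c) * (j == k)%:R
   + 2 * s * t * ((j == i)%:R * (j == k)%:R) + c ^+ 2)).
  apply: eq_bigr => j _; rewrite !mxE.
  by case: (j == i); case: (j == k) => /=; ring.
rewrite !big_split -!mulr_sumr !sum1 sum2 sumr_const card_ord /=.
by rewrite -[_ *+ n]mulr_natl; ring.
Qed.

Lemma phi_const_spikes d s i t k c :
  phi (const_mx d) (spikes s i t k c)
  = s ^+ 2 + t ^+ 2 + 2 * s * t * (i == k)%:R + n%:R * (c - d) ^+ 2
    + 2 * (s + t) * (c - d).
Proof.
rewrite phiC phi_dot -dot_spikes.
by congr dot; apply/rowP=> j; rewrite !mxE addrA.
Qed.

Lemma phi_spikes s i j t k c : i != j ->
  phi (spikes s i t k c) (spikes s j t k c) = 2 * s ^+ 2.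
Proof.
move=> ij; transitivity (dot (spikes s i (- s) j 0) (spikes s i (- s) j 0)).
  by rewrite phi_dot; congr dot; apply/rowP=> l; rewrite !mxE; ring.
by rewrite dot_spikes (negPf ij) /=; ring.
Qed.

End Householder.

Section Configurations.
Variable R : rcfType.

Lemma dot_eq0 n (w : 'rV[R]_n) : dot w w = 0 -> w = 0.
Proof.
move=> /eqP; rewrite psumr_eq0 => [/allP w0|i _]; last by rewrite -expr2 sqr_ge0.
apply/rowP=> i; rewrite mxE; apply/eqP.
by rewrite -sqrf_eq0 expr2; apply: w0; rewrite mem_index_enum.
Qed.

Lemma phi_ge0 n (x y : 'rV[R]_n) : 0 <= phi x y.
Proof. by apply: sumr_ge0 => i _; rewrite sqr_ge0. Qed.

Lemma phi_gt0 n (x y : 'rV[R]_n) : x != y -> 0 < phi x y.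
Proof.
rewrite lt0r phi_ge0 andbT; apply: contra => /eqP; rewrite phi_dot => /dot_eq0/eqP.
by rewrite subr_eq0.
Qed.

Lemma householder_swap n (u v : 'rV[R]_n) :
  dot u u = dot v v -> householder (u - v) u = v.
Proof.
move=> uv; rewrite /householder; have [ww|ww] := eqVneq (dot (u - v) (u - v)) 0.
  rewrite (dot_eq0 ww) scaler0 subr0; apply/eqP.
  by rewrite -subr_eq0 (dot_eq0 ww).
suff -> : 2 * dot u (u - v) / dot (u - v) (u - v) = 1.
  by rewrite scale1r opprB addrC subrK.
apply: (canLR (mulfK ww)); rewrite mul1r !dotE uv (dotC v u); ring.
Qed.

(** Any two points are the images of two opposite points of the diagonal under an
    isometry: reflect a diagonal vector to (x - y) / 2, then translate by the
    midpoint. *)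
Lemma diagonal_frame n (x y : 'rV[R]_n.+1) :
  exists T : 'rV[R]_n.+1 -> 'rV[R]_n.+1, exists t,
    [/\ forall u v, phi (T u) (T v) = phi u v, T (const_mx t) = x,
        T (const_mx (- t)) = y & 4 * n.+1%:R * t ^+ 2 = phi x y].
Proof.
have n1_gt0 : 0 < n.+1%:R :> R by rewrite ltr0n.
pose t := Num.sqrt (phi x y / (4 * n.+1%:R)); pose h := 2^-1 *: (x - y).
have tE : 4 * n.+1%:R * t ^+ 2 = phi x y.
  rewrite sqr_sqrtr; first by field; rewrite nat1r lt0r_neq0.
  by rewrite divr_ge0 ?phi_ge0 // mulr_ge0 // ltW.
have th : dot (const_mx t : 'rV[R]_n.+1) (const_mx t) = dot h h.
  rewrite /h dotZl dotZr -(phi_dot x y) -tE /dot.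
  under eq_bigr => i _ do rewrite !mxE.
  by rewrite sumr_const card_ord -[LHS]mulr_natl; field.
pose T u := 2^-1 *: (x + y) + householder (const_mx t - h) u.
have Tt : T (const_mx t) = x.
  rewrite /T householder_swap // -scalerDr addrACA subrr addr0.
  by rewrite -mulr2n -scaler_nat scalerA mulVf ?scale1r // pnatr_eq0.
exists T, t; split=> // [u v|].
  by rewrite !phi_dot /T opprD addrACA subrr add0r householderB dot_householder.
have -> : const_mx (- t) = - const_mx t :> 'rV[R]_n.+1.
  by apply/rowP=> i; rewrite !mxE.
rewrite /T householderN householder_swap // -scalerBr opprB addrC addrA subrK.
by rewrite -mulr2n -scaler_nat scalerA mulVf ?scale1r // pnatr_eq0.
Qed.

Lemma exists_pyramid_base n (x y : 'rV[R]_n.+1) a b :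
    0 <= b -> phi x y = 4 * a - 2 * n%:R / n.+1%:R * b ->
  exists P : 'I_n.+1 -> 'rV[R]_n.+1,
    [/\ forall i j, i != j -> phi (P i) (P j) = b,
        forall i, phi x (P i) = a & forall i, phi y (P i) = a].
Proof.
move=> b_ge0 xy; have [T [t [isoT Tx Ty tE]]] := diagonal_frame x y.
have n1_neq0 : n.+1%:R != 0 :> R by rewrite pnatr_eq0.
pose s := Num.sqrt (b / 2).
have ss : s ^+ 2 = b / 2 by rewrite sqr_sqrtr ?divr_ge0.
have tt : n.+1%:R * t ^+ 2 = a - n%:R / n.+1%:R * b / 2.
  apply: (mulfI (_ : 4 != 0)); rewrite ?pnatr_eq0 // mulrA tE xy.
  by field; rewrite nat1r.
have st : s ^+ 2 * (n%:R / n.+1%:R) + n.+1%:R * t ^+ 2 = a.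
  by rewrite tt ss; field; rewrite nat1r.
(* The shift by - s / (n + 1) puts the centroid of the s E_i at the origin. *)
exists (fun i => T (spikes s i 0 ord0 (- s / n.+1%:R))); split=> [i j ij|i|i].
- by rewrite isoT phi_spikes // ss; field.
- by rewrite -Tx isoT phi_const_spikes -[RHS]st; field; rewrite nat1r.
- by rewrite -Ty isoT phi_const_spikes -[RHS]st; field; rewrite nat1r.
Qed.

(** The hypothesis is the triangle inequality between the lengths whose squares
    are phi x y, r and r', written without square roots. *)
Lemma exists_point_at n (x y : 'rV[R]_n.+2) r r' :
    x != y -> (phi x y + r - r') ^+ 2 <= 4 * phi x y * r ->
  exists z, phi x z = r /\ phi y z = r'.
Proof.
move=> /phi_gt0 xy_gt0 tri; have [T [t [isoT Tx Ty tE]]] := diagonal_frame x y.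
have n2_neq0 : n.+2%:R != 0 :> R by rewrite pnatr_eq0.
have t_neq0 : t != 0.
  by apply: contraTneq xy_gt0 => t0; rewrite -tE t0 expr0n mulr0 ltxx.
pose c := (r' - r) / (4 * n.+2%:R * t).
pose s := Num.sqrt ((r - n.+2%:R * (c - t) ^+ 2) / 2).
have ss : s ^+ 2 = (r - n.+2%:R * (c - t) ^+ 2) / 2.
  rewrite sqr_sqrtr // divr_ge0 // subr_ge0.
  have -> : n.+2%:R * (c - t) ^+ 2 = (phi x y + r - r') ^+ 2 / (4 * phi x y).
    by rewrite -tE /c; field; rewrite t_neq0 -natrD pnatr_eq0.
  by rewrite ler_pdivrMr 1?mulr_gt0 // mulrC.
have cE : 4 * n.+2%:R * t * c = r' - r.
  by rewrite /c mulrC divfK // !mulf_neq0 // pnatr_eq0.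
pose i0 : 'I_n.+2 := ord0; pose i1 : 'I_n.+2 := lift ord0 ord0.
have i01 : (i0 == i1) = false by [].
(* E_0 - E_1 is orthogonal to the diagonal. *)
exists (T (spikes s i0 (- s) i1 c)); split.
  rewrite -Tx isoT phi_const_spikes i01 /=.
  transitivity (2 * s ^+ 2 + n.+2%:R * (c - t) ^+ 2); first by ring.
  by rewrite ss; field.
rewrite -Ty isoT phi_const_spikes i01 /=.
transitivity (2 * s ^+ 2 + n.+2%:R * (c - t) ^+ 2 + 4 * n.+2%:R * t * c).
  by ring.
by rewrite ss cE; field.
Qed.

(** One point fewer than in [exists_pyramid_base]: the simplex can then be moved
    within the bisecting hyperplane of x and y, in the direction of the missing
    vertex, which frees phi x y from any relation with a. *)
Lemma exists_equidistant_simplex n (x y : 'rV[R]_n.+2) a :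
    phi x y <= 2 * a ->
  exists Q : 'I_n.+1 -> 'rV[R]_n.+2,
    [/\ forall i j, i != j -> phi (Q i) (Q j) = a,
        forall i, phi x (Q i) = a & forall i, phi y (Q i) = a].
Proof.
move=> xy; have [T [t [isoT Tx Ty tE]]] := diagonal_frame x y.
have a_ge0 : 0 <= a by rewrite -(pmulr_rge0 _ (ltr0n R 2)) (le_trans (phi_ge0 x y)).
(* An opaque name keeps the normalization tactics from expanding n + 2. *)
have [N NE] : {N : R | N = n.+2%:R} by exists n.+2%:R.
have N_gt0 : 0 < N by rewrite NE ltr0n.
have N_neq0 := lt0r_neq0 N_gt0.
have N1_gt0 : 0 < N - 1 by rewrite NE -natr1 addrK ltr0n.
have N1_neq0 := lt0r_neq0 N1_gt0.
pose s := Num.sqrt (a / 2).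
have ss : s ^+ 2 = a / 2 by rewrite sqr_sqrtr ?divr_ge0.
pose e := a - N * t ^+ 2 - a / 2 * (1 - N^-1).
have e_ge0 : 0 <= e.
  have -> : e = (2 * a - phi x y) / 4 + a / (2 * N).
    by rewrite /e -tE -NE; field.
  by rewrite addr_ge0 // divr_ge0 ?subr_ge0 // mulr_ge0 // ltW.
pose d := Num.sqrt (s ^+ 2 / N ^+ 2 + (1 - N^-1) * e).
have dd : d ^+ 2 = s ^+ 2 / N ^+ 2 + (1 - N^-1) * e.
  rewrite sqr_sqrtr // addr_ge0 // ?divr_ge0 ?sqr_ge0 // mulr_ge0 //.
  have -> : 1 - N^-1 = (N - 1) / N by field.
  by rewrite divr_ge0 // ltW.
(* h is a root of the quadratic equation hh, with reduced discriminant
   d ^ 2. *)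
pose h := (s / N + d) * N / (N - 1).
have hh : s ^+ 2 + h ^+ 2 - (s + h) ^+ 2 / N + N * t ^+ 2 = a.
  transitivity (s ^+ 2 * (1 - N^-1) + N * t ^+ 2
                + (d ^+ 2 - s ^+ 2 / N ^+ 2) * N / (N - 1)).
    by rewrite /h; field; rewrite N_neq0 N1_neq0.
  by rewrite dd ss /e; field; rewrite N1_neq0 N_neq0.
exists (fun i => T (spikes s (lift ord0 i) h ord0 (- (s + h) / N))).
split=> [i j ij|i|i].
- by rewrite isoT phi_spikes ?(inj_eq lift_inj) // ss; field.
- rewrite -Tx isoT phi_const_spikes -[RHS]hh -NE /=.
  by field.
- rewrite -Ty isoT phi_const_spikes -[RHS]hh -NE /=.
  by field.
Qed.

End Configurations.

(** * Carried distances *)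

(** In all uses c and c' are values of one rational expression, in R and in F;
    recording both avoids embedding the rational numbers into F. *)
Definition carries (R F : fieldType) n (f : 'rV[R]_n -> 'rV[F]_n)
    (c : R) (c' : F) :=
  forall x y, phi x y = c -> phi (f x) (f y) = c'.

(** The squared distance of the two apices over a regular simplex with n + 2
    vertices, for squared lateral edges a and squared base edges b. *)
Definition pyramid_apex (F : fieldType) (n : nat) (a b : F) : F :=
  4 * a - 2 * n.+1%:R / n.+2%:R * b.

(** [pyramid_apex n a a / a]. *)
Definition apex_ratio (F : fieldType) (n : nat) : F := 2 + 2 / n.+2%:R.

Section Carried.
Variables (R : realType) (F : fieldType) (charF0 : [pchar F] =i pred0) (n : nat).
Variable f : 'rV[R]_n.+2 -> 'rV[F]_n.+2.

Let natr_neq0 := pchar0_natr_neq0 charF0.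

Lemma carries_pyramid_or_collapse a a' b b' x y :
    carries f a a' -> carries f b b' -> 0 <= b -> b' != 0 ->
    phi x y = pyramid_apex n a b ->
  f x = f y \/ phi (f x) (f y) = pyramid_apex n a' b'.
Proof.
move=> fa fb b_ge0 b'_neq0 /(exists_pyramid_base b_ge0)[P [PP xP yP]].
apply: (double_pyramid charF0 (P := f \o P) b'_neq0) => [i j ij|i|i] /=.
- exact/fb/PP.
- exact/fa/xP.
- exact/fa/yP.
Qed.

(** If f x = f y, take z at distance c from x and p from y.  Then phi (f x) (f z)
    is p', but also 0 or c', as the double pyramid with apices x and z shows; the
    bound p <= 4 c is what the existence of z requires. *)
Lemma carries_pyramid a a' b b' p p' :
    carries f a a' -> carries f b b' -> carries f p p' ->
    0 <= b -> b' != 0 -> 0 < p <= 4 * pyramid_apex n a b ->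
    p' != 0 -> p' != pyramid_apex n a' b' ->
  carries f (pyramid_apex n a b) (pyramid_apex n a' b').
Proof.
move=> fa fb fp b_ge0 b'_neq0 /andP[p_gt0 p_le] p'_neq0 p'_neqc x y xy.
have [fxy|//] := carries_pyramid_or_collapse fa fb b_ge0 b'_neq0 xy.
have c_gt0 : 0 < pyramid_apex n a b.
  by rewrite -(pmulr_rgt0 _ (ltr0n R 4)) (lt_le_trans p_gt0).
have x_neq_y : x != y.
  by apply: contraTneq c_gt0 => xy0; rewrite -xy xy0 phixx ltxx.
have [|z [xz yz]] := @exists_point_at R n x y (pyramid_apex n a b) p x_neq_y.
  by rewrite xy; nra.
move: p'_neq0 p'_neqc; rewrite -(fp _ _ yz) -fxy.
have [->|->] := carries_pyramid_or_collapse fa fb b_ge0 b'_neq0 xz.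
  by rewrite phixx eqxx.
by rewrite eqxx.
Qed.

Hypothesis f1 : carries f 1 1.

Lemma apex_ratio_neq0 : apex_ratio F n != 0.
Proof.
have -> : apex_ratio F n = 2 * n.+3%:R / n.+2%:R.
  by rewrite /apex_ratio -[n.+3%:R]natr1; field; rewrite -natrD natr_neq0.
by rewrite !mulf_neq0 ?invr_eq0.
Qed.

Lemma apex_ratio_neq1 : apex_ratio F n - 1 != 0.
Proof.
have -> : apex_ratio F n - 1 = n.+4%:R / n.+2%:R.
  rewrite /apex_ratio -[n.+4%:R]natr1 -[n.+3%:R]natr1.
  by field; rewrite -natrD natr_neq0.
by rewrite !mulf_neq0 ?invr_eq0.
Qed.

Lemma apex_ratio_gt2 : 2 < apex_ratio R n.
Proof. by rewrite ltrDl divr_gt0 ?ltr0n. Qed.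

Lemma pyramid_apex_diag (K : fieldType) (a : K) : n.+2%:R != 0 :> K ->
  pyramid_apex n a a = apex_ratio K n * a.
Proof.
move=> N; rewrite /pyramid_apex /apex_ratio -[n.+2%:R]natr1 in N *.
by field; rewrite nat1r natr1 in N *.
Qed.

Lemma carries_power k : carries f (apex_ratio R n ^+ k) (apex_ratio F n ^+ k).
Proof.
elim: k => [|k IHk] //; rewrite !exprS.
have L_gt2 := apex_ratio_gt2.
have a_gt0 : 0 < apex_ratio R n ^+ k by rewrite exprn_gt0 // (lt_trans _ L_gt2).
have a'_neq0 : apex_ratio F n ^+ k != 0 by rewrite expf_neq0 ?apex_ratio_neq0.
rewrite -!pyramid_apex_diag ?pnatr_eq0 ?natr_neq0 //.
apply: (carries_pyramid IHk IHk IHk) => //; first exact: ltW.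
  by rewrite a_gt0 pyramid_apex_diag ?pnatr_eq0 //; nra.
rewrite pyramid_apex_diag ?natr_neq0 // -subr_eq0.
have -> : apex_ratio F n ^+ k - apex_ratio F n * apex_ratio F n ^+ k
          = - ((apex_ratio F n - 1) * apex_ratio F n ^+ k) by ring.
by rewrite oppr_eq0 mulf_neq0 ?apex_ratio_neq1.
Qed.

Lemma base_ratio_bounds : 0 < (2 * n.+1%:R / n.+2%:R : R) < 2.
Proof.
rewrite divr_gt0 ?mulr_gt0 ?ltr0n //= ltr_pdivrMr ?ltr0n //.
by rewrite ltr_pM2l // ltr_nat.
Qed.

(** A power with exponent i at most 1 serves as the excluding distance p of
    [carries_pyramid]: 1 and [apex_ratio F n] differ, so one of them differs
    from c'. *)
Lemma carries_flat_pyramid k j : (0 < k)%N -> (j <= 1)%N ->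
  carries f (pyramid_apex n (apex_ratio R n ^+ k) (apex_ratio R n ^+ j))
            (pyramid_apex n (apex_ratio F n ^+ k) (apex_ratio F n ^+ j)).
Proof.
move=> k_gt0 j_le1; set c := pyramid_apex _ _ _; set c' := pyramid_apex _ _ _.
have L_gt2 := apex_ratio_gt2; have /andP[K_gt0 K_lt2] := base_ratio_bounds.
have Lk : apex_ratio R n <= apex_ratio R n ^+ k.
  by rewrite ler_eXnr // ltW // (lt_trans _ L_gt2) // ltr1n.
have Lj : 0 < apex_ratio R n ^+ j <= apex_ratio R n.
  by case: j j_le1 {c c'} => [|[|]] // _; rewrite ?expr0 ?expr1; apply/andP; split; lra.
have c_ge : apex_ratio R n <= 4 * c.
  case/andP: Lj => Lj0 LjL; rewrite /c /pyramid_apex.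
  have := ler_pM (ltW K_gt0) (ltW Lj0) (ltW K_lt2) LjL.
  by move: (_ / _ * _) => KLj; lra.
have [i i_le1 ic'] : exists2 i, (i <= 1)%N & apex_ratio F n ^+ i != c'.
  have [c'1|] := eqVneq (apex_ratio F n ^+ 0) c'; last by exists 0.
  by exists 1 => //; rewrite -c'1 expr1 expr0 -subr_eq0 apex_ratio_neq1.
have Li : 0 < apex_ratio R n ^+ i <= apex_ratio R n.
  by case: i i_le1 {ic'} => [|[|]] // _; rewrite ?expr0 ?expr1; apply/andP; split; lra.
case/andP: Lj => Lj0 _; case/andP: Li => Li0 LiL.
rewrite /c /c'.
apply: (carries_pyramid (@carries_power k) (@carries_power j)
                        (@carries_power i)) => //.
- exact: ltW.
- by rewrite expf_neq0 ?apex_ratio_neq0.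
- by rewrite Li0 (le_trans LiL).
- by rewrite expf_neq0 ?apex_ratio_neq0.
Qed.

Lemma exists_power_ge c : exists2 k, (0 < k)%N & c <= apex_ratio R n ^+ k.
Proof.
exists (Num.bound c).+1 => //; have L_gt2 := apex_ratio_gt2.
apply: ltW; apply: lt_le_trans (upper_nthrootP (leqnSn _)) _.
by rewrite lerXn2r ?nnegrE // ltW // (lt_trans _ L_gt2) // ltr0n.
Qed.

(** * Isotropic differences and injectivity *)

(** The N - 1 vectors from f x to the images of an equidistant simplex span a
    nondegenerate hyperplane, and phi (f x) (f y) = 0 makes f y - f x orthogonal
    to all of them. *)
Lemma isotropic_collapse x y : phi (f x) (f y) = 0 -> f x = f y.
Proof.
move=> fxy0; have [k _ xy_le] := exists_power_ge (phi x y).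
have [|Q [QQ xQ yQ]] := @exists_equidistant_simplex R n x y (apex_ratio R n ^+ k).
  by rewrite (le_trans xy_le) // ler_peMl ?ler1n // (le_trans (phi_ge0 x y)).
have fk := @carries_power k.
have xyQ i : dot (f y - f x) (f (Q i) - f x) = 0.
  apply: (mulfI (natr_neq0 1)); rewrite dot_phi (phiC (f y) (f x)) fxy0 phixx.
  by rewrite (fk _ _ (xQ i)) (fk _ _ (yQ i)) mulr0; ring.
have a'_neq0 : apex_ratio F n ^+ k != 0 by rewrite expf_neq0 ?apex_ratio_neq0.
have [||||||] := @simplex_normal F charF0 n.+1 (apex_ratio F n ^+ k)
  (f x) (f \o Q) (f y - f x) (f y - f x) a'_neq0 => //=.
- by move=> i; rewrite phiC; apply: fk.
- by move=> i j /QQ; apply: fk.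
- by rewrite -phi_dot phiC.
- by move/eqP; rewrite subr_eq0 => /eqP.
- by move/eqP; rewrite subr_eq0 => /eqP.
Qed.

(** The lengths sqrt (r 0) and sqrt (r 1) below become arbitrarily close as k
    grows, since r 0 - r 1 = d is constant, so some z realizes them as its
    distances from x and y. *)
Lemma carries_injective : injective f.
Proof.
move=> x y fxy; apply/eqP/negPn/negP => x_neq_y; have xy_gt0 := phi_gt0 x_neq_y.
have L_gt2 := apex_ratio_gt2; have /andP[K_gt0 K_lt2] := base_ratio_bounds.
pose d := 2 * n.+1%:R / n.+2%:R * (apex_ratio R n - 1).
have [k k_gt0 k_ge] :=
  exists_power_ge ((phi x y + d) ^+ 2 / (4 * phi x y) + apex_ratio R n).
pose r j := pyramid_apex n (apex_ratio R n ^+ k) (apex_ratio R n ^+ j).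
have rd : r 0 - r 1 = d by rewrite /r /pyramid_apex /d expr0 expr1; ring.
have r_ge : (phi x y + r 0 - r 1) ^+ 2 <= 4 * phi x y * r 0.
  rewrite -addrA rd mulrC -ler_pdivrMr ?mulr_gt0 //.
  have : 0 <= (phi x y + d) ^+ 2 / (4 * phi x y).
    by rewrite divr_ge0 ?sqr_ge0 ?mulr_ge0 ?phi_ge0.
  rewrite /r /pyramid_apex expr0 mulr1.
  move: (_ / _) (_ / _) k_ge K_lt2 => X K; lra.
have [z [xz yz]] := exists_point_at x_neq_y r_ge.
have := carries_flat_pyramid k_gt0 (leqnn 1) yz.
rewrite -fxy (carries_flat_pyramid k_gt0 (leq0n 1) xz) => /eqP.
rewrite -subr_eq0 /pyramid_apex expr0 expr1.
have -> : 4 * apex_ratio F n ^+ k - 2 * n.+1%:R / n.+2%:R * 1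
   - (4 * apex_ratio F n ^+ k - 2 * n.+1%:R / n.+2%:R * apex_ratio F n)
   = 2 * n.+1%:R / n.+2%:R * (apex_ratio F n - 1) by ring.
by apply/negP; rewrite !mulf_neq0 ?invr_eq0 ?natr_neq0 ?apex_ratio_neq1.
Qed.

End Carried.

Theorem theorem4 (R : realType) (F : fieldType) (charF0 : [pchar F] =i pred0)
    (n : nat) (n_ge2 : (2 <= n)%N) (f : 'rV[R]_n -> 'rV[F]_n)
    (f_unit : preserves_unit_distance f) (x y : 'rV[R]_n) (x_neq_y : x <> y) :
  phi (f x) (f y) <> 0.
Proof.
case: n n_ge2 f f_unit x y x_neq_y => [|[|n]] // _ f f_unit x y x_neq_y.
have f1 : carries f 1 1.
  by move=> u v uv; apply: f_unit; rewrite /euclidean_dist -/(phi u v) uv sqrtr1.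
by move=> /(isotropic_collapse charF0 f1)/(carries_injective charF0 f1).
Qed.
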